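(* For $\lambda\in(0,1)$ and $r\in[-1,1]\setminus\{0\}$, define $f_{r,\lambda}(x)=[1-\lambda+\lambda x^r]^{1/r}$. Let $T=U|T|\in\mathcal{M}_m(\mathbb{C})$ be the polar decomposition of an invertible centered matrix. If $U=V^*\,\mathrm{diag}(\alpha_1,\dots,\alpha_m)\,V$ with $V$ unitary and $\alpha_i\ne\alpha_j$ for $i\ne j$, then $$\lim_{n\to\infty}\Delta_{f_{r,\lambda}}^n(T)=U\bigl[V^*\bigl(I\circ V|T|^rV^*\bigr)V\bigr]^{1/r},$$ where $X\circ Y$ denotes the Hadamard (entrywise) product of matrices $X$ and $Y$. Especially, if $r=1$, the assumption that $T$ is centered can be removed.
   Context: $\mathcal{M}_m(\mathbb{C})$ is the set of $m\times m$ complex matrices, $|T|=(T^*T)^{1/2}$; for invertible $T$ the factor $U$ in $T=U|T|$ is unitary. The functions $f=f_{r,\lambda}$ are representing functions of operator means (power means). Induced Aluthge transformation of an invertible matrix $T=U|T|$ with $|T|=\sum_i s_iE_i$ ($s_i$ distinct eigenvalues, $E_i$ spectral projections): $\Delta_f(T)=\sum_{i,j}s_i f(s_j/s_i)\,E_iUE_j$. For $r=1$ this is $(1-\lambda)|T|U+\lambda U|T|$. Iterates: $\Delta_f^0(T)=T$, $\Delta_f^n(T)=\Delta_f(\Delta_f^{n-1}(T))$. $T=U|T|$ is centered if $\{U^{*m}|T|U^m,\ |T|,\ U^n|T|U^{*n}: n,m=1,2,\dots\}$ is a commuting set. *)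

(* Defs.v *)
From HB Require Import structures.
From mathcomp Require Import all_boot all_order all_algebra.
From mathcomp Require Import sesquilinear spectral complex.
From mathcomp Require Import boolp classical_sets reals topology normedtype.
From mathcomp Require Import sequences exp.

Set Implicit Arguments.
Unset Strict Implicit.
Unset Printing Implicit Defensive.

Import Order.TTheory GRing.Theory Num.Theory numFieldNormedType.Exports.

Local Open Scope ring_scope.
Local Open Scope classical_set_scope.
Local Open Scope sesquilinear_scope.
Local Open Scope complex_scope.

(** The library puts the norm topology on abstract [numFieldType]s only; this
    is the same instance for the concrete field [R[i]], keyed on [complex]. *)
#[non_forgetful_inheritance]
HB.instance Definition _ (R : realType) := NormedModule.copy R[i] R[i]^o.

Section MatrixFunctions.
Context {R : realType} {m : nat}.
Implicit Types (A T : 'M[R[i]]_m) (f : R -> R).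

(** Functional calculus. It is meant for Hermitian [A], whose eigenvalues
    [spectral_diag A] are real, so that taking real parts loses nothing. *)
Definition mxfun f A : 'M[R[i]]_m :=
  invmx (spectralmx A)
    *m diag_mx (map_mx (fun z : R[i] => (f (complex.Re z))%:C) (spectral_diag A))
    *m spectralmx A.

(** [A^r], for [A] positive definite *)
Definition mxpower A (r : R) : 'M[R[i]]_m := mxfun (fun x => powR x r) A.

Definition mxabs T : 'M[R[i]]_m := mxfun Num.sqrt (T^t* *m T).

(** The factor [U] of [T = U |T|], for invertible [T] *)
Definition polar_unitary T : 'M[R[i]]_m := T *m invmx (mxabs T).

(** The distinct eigenvalues of a Hermitian [A] *)
Definition distinct_eigenvalues A : seq R :=
  undup [seq complex.Re (spectral_diag A 0 i) | i : 'I_m].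

(** [eigenspace] consists of row eigenvectors; for Hermitian [A] the orthogonal
    projection onto it, acting on rows from the right, has the same matrix as
    the orthogonal projection onto the column eigenspace. *)
Definition spectral_projection A (s : R) : 'M[R[i]]_m :=
  proj_ortho (eigenspace A s%:C).

Definition induced_aluthge f T : 'M[R[i]]_m :=
  let U := polar_unitary T in
  let S := distinct_eigenvalues (mxabs T) in
  let E := spectral_projection (mxabs T) in
  \sum_(s <- S) \sum_(t <- S) (s * f (t / s))%:C *: (E s *m U *m E t).

Definition centered_family T : set 'M[R[i]]_m :=
  let U := polar_unitary T in
  [set X | exists2 k : nat, (0 < k)%N & X = U^t* ^+ k *m mxabs T *m U ^+ k]
  `|` [set mxabs T]
  `|` [set X | exists2 k : nat, (0 < k)%N & X = U ^+ k *m mxabs T *m U^t* ^+ k].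

Definition centered T : Prop :=
  forall X Y, centered_family T X -> centered_family T Y -> X *m Y = Y *m X.

Definition hadamard (X Y : 'M[R[i]]_m) : 'M[R[i]]_m := map2_mx *%R X Y.

End MatrixFunctions.

(** Representing function of the weighted power mean *)
Definition power_mean_fun {R : realType} (r lambda : R) (x : R) : R :=
  powR (1 - lambda + lambda * powR x r) r^-1.

(* Main.v *)
Require Import Defs.
From HB Require Import structures.
From mathcomp Require Import all_boot all_order all_algebra.
From mathcomp Require Import sesquilinear spectral complex.
From mathcomp Require Import boolp classical_sets reals topology normedtype.
From mathcomp Require Import derive sequences exp.
From mathcomp Require Import ring.

Set Implicit Arguments.
Unset Strict Implicit.
Unset Printing Implicit Defensive.

Import Order.TTheory GRing.Theory Num.Theory numFieldNormedType.Exports.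

Local Open Scope ring_scope.
Local Open Scope classical_set_scope.
Local Open Scope sesquilinear_scope.

(** Put [A = |T|^r] and [Phi(X) = (1 - lambda) U^* X U + lambda X], which is
    [average] below. The key point is that the Aluthge iteration is linear after
    the change of variable [X |-> X^r]:

      [Delta(U A^(1/r)) = U Phi(A)^(1/r)]   ([induced_aluthge_power_mean]).

    Write [|T| = sum_s s E_s]. The transform is the sum over [s, t] of
    [((1 - lambda) s^r + lambda t^r)^(1/r) E_s U E_t]. If [r = 1], the
    coefficient is affine and the sum is [(1 - lambda) |T| U + lambda U |T|]. If
    [T] is centered, [B = (1 - lambda) A + lambda U A U^*] commutes with every
    [E_s], and [B E_s U E_t = ((1 - lambda) s^r + lambda t^r) E_s U E_t]; hence
    the sum is [B^(1/r) U = U Phi(A)^(1/r)] ([sum_proj_calc]). The commutation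
    hypothesis passes from [A] to [Phi(A)], so the n-th iterate is
    [U (Phi^n(A))^(1/r)].

    The rows of [V] are an orthonormal eigenbasis of [U]. In this basis, [Phi]
    multiplies the entry [(i, j)] by
    [(1 - lambda) conj(alpha_i) alpha_j + lambda], which is 1 on the diagonal
    and has modulus less than 1 elsewhere because the [alpha_i] are distinct. So
    [Phi^n(A)] tends to the diagonal part of [A] in the basis [V]
    ([cvg_frob_iter_average]).

    Finally, the power [1/r] passes to the limit: all [Phi^n(A)] and their limit
    have their spectrum in a fixed interval of positive reals, on which the
    scalar power is Lipschitz, and a scalar Lipschitz function is Lipschitz on
    Hermitian matrices for the Frobenius norm ([calc_lipschitz]).

    The linear algebra is done over an arbitrary [numClosedFieldType]. *)

(** * Functional calculus of normal matrices *)

Section NormalCalculus.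
Context {C : numClosedFieldType} {m : nat}.
Implicit Types (A B X Z U V W P : 'M[C]_m) (p q v : 'rV[C]_m) (F G : C -> C).

Lemma adjmxM n1 n2 n3 (Y : 'M[C]_(n1, n2)) (Y' : 'M[C]_(n2, n3)) :
  (Y *m Y')^t* = Y'^t* *m Y^t*.
Proof. by rewrite trmx_mul map_mxM. Qed.

Lemma adjmxD A B : (A + B)^t* = A^t* + B^t*.
Proof. by rewrite linearD map_mxD. Qed.

Lemma adjmxZ (c : C) A : (c *: A)^t* = c^* *: A^t*.
Proof. by rewrite linearZ map_mxZ. Qed.

Lemma adj_diag_mx p : (diag_mx p)^t* = diag_mx (map_mx Num.conj p).
Proof. by rewrite tr_diag_mx map_diag_mx. Qed.

Lemma mul_diag_mxE n (X : 'M[C]_(m, n)) p i j :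
  (diag_mx p *m X) i j = p 0 i * X i j.
Proof. by rewrite mul_diag_mx !mxE. Qed.

Lemma mul_mx_diagE n (X : 'M[C]_(n, m)) p i j :
  (X *m diag_mx p) i j = p 0 j * X i j.
Proof. by rewrite mul_mx_diag !mxE mulrC. Qed.

Lemma unitary_adjmulK W : W \is unitarymx -> W^t* *m W = 1%:M.
Proof. by move=> uW; rewrite -[_ *m W]mul1mx mulmxA mulmxKtV. Qed.

Lemma unitary_mulKadj W : W \is unitarymx -> W *m W^t* = 1%:M.
Proof. by move/unitarymxP. Qed.

Lemma unitary1 : (1%:M : 'M[C]_m) \is unitarymx.
Proof. by apply/unitarymxP; rewrite trmx1 map_mx1 mulmx1. Qed.

(** Functional calculus of a normal matrix: [F] is applied to the eigenvalues in
    the spectral decomposition chosen by [spectralmx]. *)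
Definition calc F A : 'M[C]_m :=
  invmx (spectralmx A) *m diag_mx (map_mx F (spectral_diag A)) *m spectralmx A.

Lemma calc_normal A : A \is normalmx ->
  exists W p, [/\ W \is unitarymx, A = W^t* *m diag_mx p *m W &
    forall F, calc F A = W^t* *m diag_mx (map_mx F p) *m W].
Proof.
move=> nA; exists (spectralmx A), (spectral_diag A).
have uW := spectral_unitarymx A; split => //.
  by have /orthomx_spectralP {1}-> := nA; rewrite invmx_unitary.
by move=> F; rewrite /calc invmx_unitary.
Qed.

Lemma diag_normal W p : W \is unitarymx ->
  W^t* *m diag_mx p *m W \is normalmx.
Proof.
move=> uW; apply/orthomx_spectral_subproof; exists (W, p) => //=.
by rewrite invmx_unitary.
Qed.

(** Entrywise, the hypothesis reads [(p_i - q_j) Z_ij = 0], so that [Z_ij]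
    vanishes unless [p_i = q_j]. *)
Lemma diag_intertwine F p q Z :
  diag_mx p *m Z = Z *m diag_mx q ->
  diag_mx (map_mx F p) *m Z = Z *m diag_mx (map_mx F q).
Proof.
move=> /matrixP pZ; apply/matrixP => i j; have := pZ i j.
rewrite !mul_diag_mxE !mul_mx_diagE !mxE => /eqP.
rewrite -subr_eq0 -mulrBl mulf_eq0 => /orP[|/eqP->]; last by rewrite !mulr0.
by rewrite subr_eq0 => /eqP ->.
Qed.

(** The functional calculus does not depend on the unitary diagonalization used
    to compute it. *)
Lemma calc_diag F W p : W \is unitarymx ->
  calc F (W^t* *m diag_mx p *m W) = W^t* *m diag_mx (map_mx F p) *m W.
Proof.
move=> uW; have [W' [p' [uW' eA ->]]] := calc_normal (diag_normal p uW).
have : diag_mx p' *m (W' *m W^t*) = W' *m W^t* *m diag_mx p.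
  have /(congr1 (fun X => W' *m X *m W^t*)) := eA.
  by rewrite !mulmxA (unitary_mulKadj uW') mul1mx mulmxtVK // => ->.
move=> /(diag_intertwine F).
move=> /(congr1 (fun X => W'^t* *m X *m W)).
by rewrite !mulmxA (unitary_adjmulK uW') mul1mx mulmxKtV.
Qed.

Lemma calc_intertwine F A B X : A \is normalmx -> B \is normalmx ->
  A *m X = X *m B -> calc F A *m X = X *m calc F B.
Proof.
move=> hA hB; have [W [p [uW eA fA]]] := calc_normal hA.
have [W' [q [uW' eB fB]]] := calc_normal hB.
rewrite fA fB {1}eA {1}eB => /(congr1 (fun Y => W *m Y *m W'^t*)).
rewrite !mulmxA (unitary_mulKadj uW) mul1mx mulmxtVK // => e.
have := @diag_intertwine F p q (W *m X *m W'^t*).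
rewrite !mulmxA => /(_ e) /(congr1 (fun Y => W^t* *m Y *m W')).
by rewrite !mulmxA (unitary_adjmulK uW) mul1mx mulmxKtV.
Qed.

Lemma scalar_normal (c : C) : (c%:M : 'M[C]_m) \is normalmx.
Proof. by apply/normalmxP; rewrite scalar_mxC. Qed.

Lemma calc_scalar F (c : C) : calc F (c%:M : 'M[C]_m) = (F c)%:M.
Proof.
have := calc_diag F (const_mx c) unitary1.
by rewrite trmx1 map_mx1 !mul1mx !mulmx1 map_const_mx !diag_const_mx.
Qed.

Lemma calc_eigen F A X (c : C) : A \is normalmx ->
  A *m X = c *: X -> calc F A *m X = F c *: X.
Proof.
move=> hA AX; have := @calc_intertwine F A c%:M X hA (scalar_normal c).
by rewrite calc_scalar !mul_mx_scalar => ->.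
Qed.

Lemma calc_comp F G A : A \is normalmx -> calc F (calc G A) = calc (F \o G) A.
Proof.
move=> /calc_normal[W [p [uW _ fA]]]; rewrite !fA calc_diag //.
by rewrite -map_mx_comp.
Qed.

Lemma calc_comm F A B : A \is normalmx -> B \is normalmx ->
  A *m B = B *m A -> calc F A *m calc F B = calc F B *m calc F A.
Proof.
move=> hA hB AB; apply: calc_intertwine => //; apply/esym.
exact: calc_intertwine.
Qed.

Lemma conj_normal U A : U \is unitarymx -> A \is normalmx ->
  U^t* *m A *m U \is normalmx.
Proof.
move=> uU /calc_normal[W [p [uW -> _]]].
have := diag_normal p (mul_unitarymx uW uU).
by rewrite adjmxM !mulmxA.
Qed.

Lemma calc_conj F U A : U \is unitarymx -> A \is normalmx ->
  calc F (U^t* *m A *m U) = U^t* *m calc F A *m U.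
Proof.
move=> uU hA; apply/esym; rewrite -mulmxA.
rewrite (@calc_intertwine F A (U^t* *m A *m U)) ?conj_normal //.
  by rewrite mulmxA unitary_adjmulK // mul1mx.
by rewrite !mulmxA unitary_mulKadj // mul1mx.
Qed.

(** The orthogonal projection onto an eigenspace is the indicator function of
    the eigenvalue, applied to the matrix. *)
Lemma proj_ortho_eigenspace W p (s : C) : W \is unitarymx ->
  proj_ortho (eigenspace (W^t* *m diag_mx p *m W) s) =
  W^t* *m diag_mx (map_mx (fun x => (x == s)%:R) p) *m W.
Proof.
move=> uW; set P := W^t* *m _ *m _; set E := proj_ortho _.
set D := diag_mx (map_mx _ p).
have FP : W^t* *m D *m W *m P = s *: (W^t* *m D *m W).
  rewrite /P !mulmxA mulmxtVK // -[X in X *m W]mulmxA mulmx_diag.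
  rewrite scalemxAl scalemxAr -linearZ /=; congr (_ *m diag_mx _ *m _).
  apply/rowP => i; rewrite !mxE.
  by case: eqP => [->|]; rewrite ?mulr0 ?mul0r // mulrC.
have FE : W^t* *m D *m W *m E = W^t* *m D *m W.
  by apply: proj_ortho_id; apply/eigenspaceP.
have FX : eigenspace P s *m (W^t* *m D *m W) = eigenspace P s.
  have /eigenspaceP : (eigenspace P s <= eigenspace P s)%MS by [].
  move: (eigenspace P s) => X.
  rewrite /P !mulmxA => /(congr1 (fun Y => Y *m W^t*)).
  rewrite mulmxtVK // => XP.
  rewrite -[RHS](mulmxKtV _ uW (erefl m)); congr (_ *m W).
  move/matrixP : XP => XP; apply/matrixP => i j; have := XP i j.
  rewrite -scalemxAl !mul_mx_diagE !mxE => /eqP; rewrite -subr_eq0 -mulrBl.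
  rewrite mulf_eq0 subr_eq0 => /orP[->|/eqP->]; first by rewrite mul1r.
  by rewrite mulr0.
have FC : (W^t* *m D *m W)^t* = W^t* *m D *m W.
  rewrite !adjmxM trmxCK adj_diag_mx mulmxA; congr (_ *m diag_mx _ *m _).
  by apply/rowP => i; rewrite !mxE; case: eqP; rewrite ?conjC1 ?conjC0.
have : (1%:M - W^t* *m D *m W) *m E = 0.
  apply: proj_ortho_0; apply/orthomx1P.
  by rewrite mulmxBl mul1mx -{1}FC -adjmxM FX subrr.
by rewrite mulmxBl mul1mx FE => /eqP; rewrite subr_eq0 => /eqP.
Qed.

End NormalCalculus.

(** * Spectral intervals, averaging and Lipschitz bounds *)

Section SpectrumWithin.
Context {C : numClosedFieldType} {m : nat}.
Implicit Types (A B X Z U V W P : 'M[C]_m) (p q v w : 'rV[C]_m) (F G : C -> C).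
Implicit Types (a b l : C).

(** [A] is unitarily diagonalizable with spectrum in the interval from [a] to
    [b]. The order of [C] is partial: [a <= z] forces [z] to be real, and thus
    [A] to be Hermitian, when [a] is real. *)
Definition spectrum_within a b A :=
  exists W p, [/\ W \is unitarymx, A = W^t* *m diag_mx p *m W &
    forall i, a <= p 0 i <= b].

Lemma form_diag w p :
  (w *m diag_mx p *m w^t*) 0 0 = \sum_i p 0 i * `|w 0 i| ^+ 2.
Proof.
rewrite mxE; apply: eq_bigr => i _; rewrite mul_mx_diagE !mxE normCK.
by rewrite mulrA.
Qed.

Lemma form_norm w : (w *m w^t*) 0 0 = \sum_i `|w 0 i| ^+ 2.
Proof. by rewrite mxE; apply: eq_bigr => i _; rewrite !mxE normCK. Qed.

Lemma form_conj U A v :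
  (v *m (U^t* *m A *m U) *m v^t*) 0 0 =
  (v *m U^t* *m A *m (v *m U^t*)^t*) 0 0.
Proof. by rewrite adjmxM trmxCK !mulmxA. Qed.

Lemma norm_unitary U v : U \is unitarymx ->
  (v *m U^t* *m (v *m U^t*)^t*) 0 0 = (v *m v^t*) 0 0.
Proof. by move=> uU; rewrite adjmxM trmxCK !mulmxA mulmxKtV. Qed.

(** A numerical range criterion: with its converse [form_within], it replaces
    spectral bounds by bounds on a quadratic form, which are stable under convex
    combinations. *)
Lemma within_form a b A v : spectrum_within a b A ->
  a * (v *m v^t*) 0 0 <= (v *m A *m v^t*) 0 0 <= b * (v *m v^t*) 0 0.
Proof.
move=> [W [p [uW -> hp]]]; rewrite form_conj -(norm_unitary v uW).
move: (v *m W^t*) => w; rewrite form_diag form_norm !mulr_sumr.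
apply/andP; split; apply: ler_sum => i _; rewrite ler_wpM2r ?exprn_ge0 //.
  by case/andP: (hp i).
by case/andP: (hp i).
Qed.

Lemma form_row V A i :
  (row i V *m A *m (row i V)^t*) 0 0 = (V *m A *m V^t*) i i.
Proof.
by rewrite -row_mul !mxE; apply: eq_bigr => j _; rewrite !mxE.
Qed.

Lemma norm_row_unitary V i : V \is unitarymx ->
  (row i V *m (row i V)^t*) 0 0 = 1.
Proof.
move=> uV; have := form_row V 1%:M i; rewrite !mulmx1 => ->.
by rewrite unitary_mulKadj // mxE eqxx.
Qed.

Lemma form_within a b A : A \is normalmx ->
  (forall v, a * (v *m v^t*) 0 0 <= (v *m A *m v^t*) 0 0
             <= b * (v *m v^t*) 0 0) ->
  spectrum_within a b A.
Proof.
move=> /calc_normal[W [p [uW eA _]]] hA; exists W, p; split => // i.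
have := hA (row i W); rewrite norm_row_unitary // !mulr1 form_row eA.
rewrite !mulmxA unitary_mulKadj // mul1mx mulmxtVK //.
by rewrite mxE eqxx mulr1n.
Qed.

Lemma within_normal a b A : spectrum_within a b A -> A \is normalmx.
Proof. by move=> [W [p [uW -> _]]]; exact: diag_normal. Qed.

Lemma within_adj a b A : 0 <= a -> spectrum_within a b A -> A^t* = A.
Proof.
move=> a0 [W [p [uW -> hp]]]; rewrite !adjmxM trmxCK adj_diag_mx mulmxA.
congr (_ *m diag_mx _ *m _); apply/rowP => i; rewrite mxE.
by rewrite conj_Creal // ger0_real // (le_trans a0) //; case/andP: (hp i).
Qed.

Lemma adj_normal A : A^t* = A -> A \is normalmx.
Proof. by move=> hA; apply/normalmxP; rewrite hA. Qed.

(** The map whose iterates drive the induced Aluthge transformation. *)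
Definition average l U A := (1 - l) *: (U^t* *m A *m U) + l *: A.

Lemma within_average a b l U A : U \is unitarymx -> 0 <= a -> 0 <= l <= 1 ->
  spectrum_within a b A -> spectrum_within a b (average l U A).
Proof.
move=> uU a0 /andP[l0 l1] wA; have hA := within_adj a0 wA.
have l'0 : 0 <= 1 - l by rewrite subr_ge0.
apply: form_within.
  apply: adj_normal; rewrite adjmxD !adjmxZ !adjmxM trmxCK hA mulmxA.
  by rewrite !conj_Creal ?ger0_real.
have E (Y Z : 'M[C]_1) :
    ((1 - l) *: Y + l *: Z) 0 0 = (1 - l) * Y 0 0 + l * Z 0 0.
  by rewrite !mxE.
move=> v; rewrite mulmxDr mulmxDl -!scalemxAr -!scalemxAl E form_conj.
have /andP[h1 h2] := within_form v wA.
have /andP[h3 h4] := within_form (v *m U^t*) wA.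
rewrite norm_unitary // in h3 h4.
have e (c : C) : c = (1 - l) * c + l * c by rewrite -mulrDl subrK mul1r.
apply/andP; split.
  by rewrite [leLHS]e lerD // ler_wpM2l.
by rewrite [leRHS]e lerD // ler_wpM2l.
Qed.

(** The diagonal part of [A] in the orthonormal basis given by [V]. *)
Definition pinching V A :=
  V^t* *m diag_mx (\row_i (V *m A *m V^t*) i i) *m V.

Lemma within_pinching a b V A : V \is unitarymx ->
  spectrum_within a b A -> spectrum_within a b (pinching V A).
Proof.
move=> uV wA; exists V, (\row_i (V *m A *m V^t*) i i); split=> // i.
rewrite mxE -form_row; have := within_form (row i V) wA.
by rewrite norm_row_unitary // !mulr1.
Qed.

(** The square of the Frobenius norm. *)
Definition frob X := \sum_i \sum_j `|X i j| ^+ 2.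

Lemma frobE X : frob X = \tr (X *m X^t*).
Proof.
rewrite /mxtrace; apply: eq_bigr => i _; rewrite mxE; apply: eq_bigr => j _.
by rewrite !mxE normCK.
Qed.

Lemma frob_unitaryr X U : U \is unitarymx -> frob (X *m U) = frob X.
Proof. by move=> uU; rewrite !frobE adjmxM mulmxA mulmxtVK. Qed.

Lemma frob_unitaryl U X : U \is unitarymx -> frob (U *m X) = frob X.
Proof.
move=> uU; rewrite !frobE adjmxM -mulmxA mxtrace_mulC -!mulmxA.
by rewrite unitary_adjmulK // mulmx1.
Qed.

Lemma adj_unitary U : U \is unitarymx -> U^t* \is unitarymx.
Proof. by rewrite trmxC_unitary. Qed.

(** A function that is Lipschitz on an interval is Lipschitz for the Frobenius
    norm, with the same constant, on matrices with spectrum there: in eigenbases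
    of [A] and of [B], the entries of [F(A) - F(B)] are [(F p_i - F q_j) Z_ij]
    and those of [A - B] are [(p_i - q_j) Z_ij], for a common matrix [Z]. *)
Lemma calc_lipschitz F (L a b : C) A B : 0 <= L ->
  (forall x y, a <= x <= b -> a <= y <= b -> `|F x - F y| <= L * `|x - y|) ->
  spectrum_within a b A -> spectrum_within a b B ->
  frob (calc F A - calc F B) <= L ^+ 2 * frob (A - B).
Proof.
move=> L0 LF [W [p [uW -> hp]]] [W' [q [uW' -> hq]]].
have frobWW' X : frob X = frob (W *m X *m W'^t*).
  by rewrite frob_unitaryr ?adj_unitary // frob_unitaryl.
rewrite !calc_diag // frobWW' [in leRHS]frobWW'.
rewrite !mulmxBr !mulmxBl !mulmxA !unitary_mulKadj // !mul1mx !(mulmxtVK _ uW').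
rewrite -!(mulmxA _ W); move: (W *m W'^t*) => Z.
rewrite /frob mulr_sumr; apply: ler_sum => i _.
rewrite mulr_sumr; apply: ler_sum => j _.
have E (p' q' : 'rV[C]_m) : (diag_mx p' *m Z - Z *m diag_mx q') i j =
    (p' 0 i - q' 0 j) * Z i j.
  by rewrite mulrBl -mul_diag_mxE -mul_mx_diagE !mxE.
rewrite !E !normrM !exprMn [leRHS]mulrA -[L ^+ 2 * _]exprMn.
rewrite ler_wpM2r ?exprn_ge0 //.
by rewrite !mxE lerXn2r ?nnegrE ?mulr_ge0 //; exact: LF.
Qed.

End SpectrumWithin.

(** * Iterated averages and kernels over spectral projections *)

Section Iterates.
Context {C : numClosedFieldType} {m : nat}.
Implicit Types (A B X Z U V W P : 'M[C]_m) (p q v w alpha : 'rV[C]_m).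
Implicit Types (F G : C -> C) (l : C).

(** Strict convexity of the unit disk, through the identity
    [|(1 - l) z + l|^2 = 1 - l (1 - l) |z - 1|^2] for [|z| = 1]. *)
Lemma norm_average_lt1 l (z : C) : 0 < l < 1 -> `|z| = 1 -> z != 1 ->
  `|(1 - l) * z + l| < 1.
Proof.
move=> /andP[l0 l1] z1 zn1.
have zz : z * z^* = 1 by rewrite -normCK z1 expr1n.
have lR : l^* = l by rewrite conj_Creal // ger0_real // ltW.
rewrite -(@expr_lt1 _ 2) // normCK rmorphD rmorphM rmorphB rmorph1 /= lR.
have -> : ((1 - l) * z + l) * ((1 - l) * z^* + l) =
    1 - l * (1 - l) * `|z - 1| ^+ 2.
  rewrite normCK rmorphB rmorph1.
  transitivity ((1 - l) ^+ 2 * (z * z^*) + l * (1 - l) * (z + z^*) + l ^+ 2).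
    by ring.
  transitivity (1 - l * (1 - l) * (z * z^* + 1 - (z + z^*))); last by ring.
  by rewrite zz; ring.
have z1_gt0 : 0 < `|z - 1| by rewrite normr_gt0 subr_eq0.
by rewrite ltrBlDr ltrDl !mulr_gt0 // subr_gt0.
Qed.

(** In an eigenbasis of [U], averaging acts as a Schur multiplier. *)
Lemma average_coef l U V alpha A i j : V \is unitarymx ->
  U = V^t* *m diag_mx alpha *m V ->
  (V *m average l U A *m V^t*) i j =
  ((1 - l) * ((alpha 0 i)^* * alpha 0 j) + l) * (V *m A *m V^t*) i j.
Proof.
move=> uV ->; rewrite /average mulmxDr mulmxDl -!scalemxAr -!scalemxAl.
rewrite !adjmxM trmxCK !mulmxA (unitary_mulKadj uV) mul1mx (mulmxtVK _ uV).
rewrite adj_diag_mx -!(mulmxA (diag_mx _)).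
move: (V *m A *m V^t*) => Q.
have E (Y Z : 'M[C]_m) :
  ((1 - l) *: Y + l *: Z) i j = (1 - l) * Y i j + l * Z i j by rewrite !mxE.
rewrite E mul_diag_mxE mul_mx_diagE mxE. by ring.
Qed.

Lemma iter_average_coef l U V alpha A n i j : V \is unitarymx ->
  U = V^t* *m diag_mx alpha *m V ->
  (V *m iter n (average l U) A *m V^t*) i j =
  ((1 - l) * ((alpha 0 i)^* * alpha 0 j) + l) ^+ n * (V *m A *m V^t*) i j.
Proof.
move=> uV eU; elim: n => [|n IH]; first by rewrite expr0 mul1r.
by rewrite iterS (average_coef _ _ _ _ uV eU) IH exprS mulrA.
Qed.

Lemma unitary_diag_norm U V alpha i : U \is unitarymx -> V \is unitarymx ->
  U = V^t* *m diag_mx alpha *m V -> `|alpha 0 i| = 1.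
Proof.
move=> uU uV eU; have := unitary_mulKadj uU.
rewrite {1}eU {1}eU !adjmxM trmxCK adj_diag_mx.
rewrite !mulmxA (mulmxtVK _ uV) => /(congr1 (fun X => V *m X *m V^t*)).
rewrite !mulmxA (unitary_mulKadj uV) mul1mx (mulmxtVK _ uV) mulmx1.
rewrite (unitary_mulKadj uV) => /matrixP/(_ i i).
rewrite mulmx_diag !mxE eqxx !mulr1n -normCK => /eqP.
by rewrite sqrp_eq1 // => /eqP.
Qed.

Lemma frob_iter_average l U V alpha A n : 0 < l < 1 ->
  U \is unitarymx -> V \is unitarymx ->
  U = V^t* *m diag_mx alpha *m V ->
  frob (iter n (average l U) A - pinching V A) =
  \sum_i \sum_(j | j != i)
    (`|(1 - l) * ((alpha 0 i)^* * alpha 0 j) + l| ^+ 2) ^+ n *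
    `|(V *m A *m V^t*) i j| ^+ 2.
Proof.
move=> hl uU uV eU.
rewrite -(frob_unitaryl _ uV) -(frob_unitaryr _ (adj_unitary uV)).
apply: eq_bigr => i _; rewrite (bigD1 i) //=.
have E j : (V *m (iter n (average l U) A - pinching V A) *m V^t*) i j =
    ((1 - l) * ((alpha 0 i)^* * alpha 0 j) + l) ^+ n * (V *m A *m V^t*) i j
    - (V *m A *m V^t*) i i *+ (i == j).
  rewrite mulmxBr mulmxBl -(iter_average_coef _ _ _ _ _ uV eU).
  rewrite /pinching !mulmxA (unitary_mulKadj uV) mul1mx (mulmxtVK _ uV).
  by rewrite !mxE.
rewrite E eqxx mulrC mulr1n -[(alpha 0 i)^* * _]mulrC -normCK.
rewrite (unitary_diag_norm _ uU uV eU) expr1n mulr1 subrK expr1n mulr1 subrr.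
rewrite normr0 expr0n add0r; apply: eq_bigr => j ji.
rewrite E eq_sym (negbTE ji) mulr0n subr0 normrM normrX exprMn.
by rewrite -!exprM mulnC.
Qed.

Lemma pinching_hadamard V A : pinching V A =
  V^t* *m map2_mx *%R 1%:M (V *m A *m V^t*) *m V.
Proof.
congr (_ *m _ *m _); apply/matrixP => i j; rewrite !mxE.
by case: eqP => [->|]; rewrite ?mul1r ?mul0r.
Qed.

Section SchurMultiplier.
Context (I : Type) (S : seq I) (e : I -> C) (P : 'M[C]_m).
Context (nP : P \is normalmx).
Let E s := calc (fun x => (x == e s)%:R) P.
(* Every eigenvalue of [P] is the value of [e] at exactly one item of [S]. *)
Context (sumE : \sum_(s <- S) E s = 1%:M).

Lemma mul_mx_proj s : P *m E s = e s *: E s.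
Proof.
have [W [p [uW eP fP]]] := calc_normal nP; rewrite /E fP {1}eP.
rewrite !mulmxA (mulmxtVK _ uW) -[X in X *m W]mulmxA mulmx_diag.
rewrite scalemxAl scalemxAr -linearZ /=; congr (_ *m diag_mx _ *m _).
apply/rowP => i; rewrite !mxE.
by case: eqP => [->|]; rewrite ?mulr0 ?mul0r // mulrC.
Qed.

Lemma proj_comm s X : P *m X = X *m P -> E s *m X = X *m E s.
Proof. by move=> PX; apply: calc_intertwine. Qed.

Lemma mul_proj_mx s : E s *m P = e s *: E s.
Proof. by rewrite (proj_comm _ (erefl _)) mul_mx_proj. Qed.

(** An affine kernel gives back the classical Aluthge-type combination of
    [P U] and [U P]. No commutation is needed. *)
Lemma sum_proj_affine l U :
  \sum_(s <- S) \sum_(t <- S) ((1 - l) * e s + l * e t) *: (E s *m U *m E t) =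
  (1 - l) *: (P *m U) + l *: (U *m P).
Proof.
transitivity (\sum_(s <- S) \sum_(t <- S)
   E s *m ((1 - l) *: (P *m U) + l *: (U *m P)) *m E t).
  apply: eq_bigr => s _; apply: eq_bigr => t _.
  rewrite mulmxDr mulmxDl -!scalemxAr -!scalemxAl scalerDl -!scalerA.
  congr (_ *: _ + _ *: _).
    by rewrite [E s *m (P *m U)]mulmxA mul_proj_mx -!scalemxAl.
  by rewrite -[RHS]mulmxA -[U *m P *m E t]mulmxA mul_mx_proj -!scalemxAr mulmxA.
rewrite -[RHS]mulmx1 -[in RHS]sumE -[X in _ = X *m _]mul1mx -[in RHS]sumE.
by rewrite !mulmx_suml; apply: eq_bigr => s _; rewrite mulmx_sumr.
Qed.

(** Let [B = (1 - l) A + l U A U^*]. Since [A] commutes with [U A U^*], [B]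
    commutes with every projection [E s], and [B E_s U E_t] equals
    [((1 - l) F(s) + l F(t)) E_s U E_t]: the columns of [E_s U E_t] lie
    in an eigenspace of [B], on which [G B] acts as a scalar. The hypothesis on
    commutants holds when [F] is injective on the spectrum of [P]. *)
Lemma sum_proj_calc F G U l (A := calc F P) : U \is unitarymx ->
  (forall X, A *m X = X *m A -> P *m X = X *m P) ->
  A *m (U *m A *m U^t*) = U *m A *m U^t* *m A ->
  average l U A \is normalmx ->
  \sum_(s <- S) \sum_(t <- S) G ((1 - l) * F (e s) + l * F (e t)) *:
     (E s *m U *m E t) =
  U *m calc G (average l U A).
Proof.
move=> uU cA AU nB; pose B := U *m average l U A *m U^t*.
have eB : B = (1 - l) *: A + l *: (U *m A *m U^t*).
  rewrite /B /average mulmxDr mulmxDl -!scalemxAr -!scalemxAl !mulmxA.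
  by rewrite (unitary_mulKadj uU) mul1mx (mulmxtVK _ uU).
have nB' : B \is normalmx.
  by have := conj_normal (adj_unitary uU) nB; rewrite trmxCK.
have AE s : A *m E s = F (e s) *: E s.
  by apply: calc_eigen; rewrite ?mul_mx_proj.
have EA s : E s *m A = F (e s) *: E s by rewrite (proj_comm s (cA A erefl)).
have EB s : E s *m B = B *m E s.
  apply/proj_comm/cA; rewrite eB mulmxDr mulmxDl -!scalemxAr -!scalemxAl.
  by rewrite AU.
have BU : B *m U = (1 - l) *: (A *m U) + l *: (U *m A).
  by rewrite eB mulmxDl -!scalemxAl (mulmxKtV _ uU).
have -> : U *m calc G (average l U A) = calc G B *m U.
  by apply/esym/calc_intertwine => //; rewrite /B (mulmxKtV _ uU).
transitivity (\sum_(s <- S) \sum_(t <- S) calc G B *m (E s *m U *m E t)).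
  apply: eq_bigr => s _; apply: eq_bigr => t _; apply/esym/calc_eigen => //.
  rewrite [LHS]mulmxA [B *m (E s *m U)]mulmxA -EB -[E s *m B *m U]mulmxA BU.
  rewrite mulmxDr mulmxDl.
  rewrite -!scalemxAr -!scalemxAl [E s *m (A *m U)]mulmxA EA.
  rewrite [E s *m (U *m A)]mulmxA -[E s *m U *m A *m _]mulmxA AE.
  by rewrite -!scalemxAr -!scalemxAl !scalerA -scalerDl.
rewrite -[U in RHS]mulmx1 -[U in RHS]mul1mx -!sumE !mulmx_suml mulmx_sumr.
by apply: eq_bigr => s _; rewrite !mulmx_sumr.
Qed.

End SchurMultiplier.
End Iterates.

(** * Spectral projections and commuting conjugates *)

Section SpectralData.
Context {C : numClosedFieldType} {m : nat}.
Implicit Types (A B X Z U V W P : 'M[C]_m) (p q v w : 'rV[C]_m).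
Implicit Types (F G : C -> C) (a b l : C).

(** The bounds hold for the eigenvalues listed by [spectral_diag], not just for
    those of the decomposition that comes with [spectrum_within]. *)
Lemma within_spectral_diag a b A i : spectrum_within a b A ->
  a <= spectral_diag A 0 i <= b.
Proof.
move=> wA; have nA := within_normal wA; have uW := spectral_unitarymx A.
have := within_form (row i (spectralmx A)) wA.
rewrite norm_row_unitary // !mulr1 form_row.
have /orthomx_spectralP := nA; rewrite invmx_unitary // => {2 5}->.
rewrite !mulmxA (unitary_mulKadj uW) mul1mx (mulmxtVK _ uW).
by rewrite mxE eqxx mulr1n.
Qed.

Lemma calc_id F a b A : spectrum_within a b A ->
  (forall x, a <= x <= b -> F x = x) -> calc F A = A.
Proof.
move=> [W [p [uW -> hp]]] FG; rewrite !calc_diag //.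
by congr (_ *m diag_mx _ *m _); apply/rowP => i; rewrite !mxE FG.
Qed.

Lemma within_calc F a b a' b' A : spectrum_within a b A ->
  (forall x, a <= x <= b -> a' <= F x <= b') ->
  spectrum_within a' b' (calc F A).
Proof.
move=> [W [p [uW -> hp]]] FG; rewrite !calc_diag //.
by exists W, (map_mx F p); split=> // i; rewrite mxE FG.
Qed.

Lemma within_unit a b A : 0 < a -> spectrum_within a b A -> A \in unitmx.
Proof.
move=> a0 [W [p [uW -> hp]]].
rewrite !unitmx_mul (unitarymx_unit uW) (unitarymx_unit (adj_unitary uW)).
rewrite andbT /= unitmxE det_diag unitfE; apply/prodf_neq0 => i _.
by rewrite gt_eqF // (lt_le_trans a0) //; case/andP: (hp i).
Qed.

Lemma unit_diag_neq0 W p : W \is unitarymx ->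
  W^t* *m diag_mx p *m W \in unitmx -> forall i, p 0 i != 0.
Proof.
move=> uW; rewrite !unitmx_mul (unitarymx_unit uW).
rewrite (unitarymx_unit (adj_unitary uW)) andbT /= unitmxE det_diag unitfE.
by move=> /prodf_neq0 h i; exact: h.
Qed.

Lemma calc_sqrt_adj_mul F a b U P : 0 <= a -> U \is unitarymx ->
  spectrum_within a b P -> (forall x, a <= x <= b -> F (x ^+ 2) = x) ->
  calc F ((U *m P)^t* *m (U *m P)) = P.
Proof.
move=> a0 uU wP hF; have := within_adj a0 wP; case: wP => W [p [uW eP hp]] hP.
have -> : (U *m P)^t* *m (U *m P) =
    W^t* *m diag_mx (\row_i (p 0 i ^+ 2)) *m W.
  rewrite adjmxM !mulmxA mulmxKtV // hP eP !mulmxA mulmxtVK //.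
  rewrite -[X in X *m W]mulmxA mulmx_diag.
  by congr (_ *m diag_mx _ *m _); apply/rowP => i; rewrite !mxE expr2.
rewrite calc_diag // eP; congr (_ *m diag_mx _ *m _).
by apply/rowP => i; rewrite !mxE hF.
Qed.

Lemma proj_ortho_calc P (s : C) : P \is normalmx ->
  proj_ortho (eigenspace P s) = calc (fun x => (x == s)%:R) P.
Proof.
move=> /calc_normal[W [p [uW eP fP]]].
by rewrite fP {1}eP proj_ortho_eigenspace.
Qed.

Lemma sum_calc_proj (I : Type) (S : seq I) (e : I -> C) P :
  (forall i, \sum_(s <- S) (spectral_diag P 0 i == e s)%:R = 1 :> C) ->
  \sum_(s <- S) calc (fun x => (x == e s)%:R) P = 1%:M.
Proof.
move=> hS; rewrite -mulmx_suml -mulmx_sumr.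
have -> : \sum_(s <- S)
    diag_mx (map_mx (fun x => (x == e s)%:R) (spectral_diag P)) =
    1%:M :> 'M[C]_m.
  apply/matrixP => i j; rewrite summxE !mxE.
  transitivity (\sum_(s <- S) (spectral_diag P 0 i == e s)%:R *+ (i == j) : C).
    by apply: eq_bigr => s _; rewrite !mxE.
  by rewrite sumrMnl hS.
by rewrite mulmx1 mulVmx // spectral_unit.
Qed.

(** Conjugation by a unitary [U], in the direction of [average]. *)
Definition conj_by U A := U^t* *m A *m U.

(** The part of the centered condition that is used: the matrices
    [U^*k A U^k] with [k >= 0] commute with each other. Unlike the two-sided
    condition it mentions no polar decomposition, and averaging preserves it. *)
Definition commuting_conjugates U A := forall j k,
  iter j (conj_by U) A *m iter k (conj_by U) A =
  iter k (conj_by U) A *m iter j (conj_by U) A.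

Lemma iter_conj_normal U A k : U \is unitarymx -> A \is normalmx ->
  iter k (conj_by U) A \is normalmx.
Proof. by move=> uU nA; elim: k => //= k; exact: conj_normal. Qed.

Lemma iter_conj_calc F U A k : U \is unitarymx -> A \is normalmx ->
  iter k (conj_by U) (calc F A) = calc F (iter k (conj_by U) A).
Proof.
move=> uU nA; elim: k => //= k ->.
by rewrite /conj_by -calc_conj // iter_conj_normal.
Qed.

Lemma commuting_conjugates_calc F U A : U \is unitarymx -> A \is normalmx ->
  commuting_conjugates U A -> commuting_conjugates U (calc F A).
Proof.
move=> uU nA cA j k; rewrite !iter_conj_calc //.
by apply: calc_comm => //; exact: iter_conj_normal.
Qed.

Lemma iter_conj_average U A l k :
  iter k (conj_by U) (average l U A) =
  (1 - l) *: iter k.+1 (conj_by U) A + l *: iter k (conj_by U) A.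
Proof.
elim: k => // k IH; rewrite iterS IH {1}/conj_by.
by rewrite mulmxDr mulmxDl -!scalemxAr -!scalemxAl.
Qed.

Lemma commuting_conjugates_average l U A :
  commuting_conjugates U A -> commuting_conjugates U (average l U A).
Proof.
move=> cA j k; rewrite !iter_conj_average.
rewrite !(mulmxDl, mulmxDr) -!scalemxAr -!scalemxAl.
rewrite (cA j.+1 k.+1) (cA j.+1 k) (cA j k.+1) (cA j k) -!addrA.
by congr (_ + _); rewrite !scalerA [l * _]mulrC addrCA.
Qed.

(** The map [X |-> U X U^*] sends the pair [(A, U^* A U)] to [(U A U^*, A)]. *)
Lemma commuting_conjugates_inv U A : U \is unitarymx ->
  commuting_conjugates U A ->
  A *m (U *m A *m U^t*) = U *m A *m U^t* *m A.
Proof.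
move=> uU /(_ 1%N 0%N)/= /(congr1 (fun X => U *m X *m U^t*)).
rewrite /conj_by !mulmxA (unitary_mulKadj uU) mul1mx (mulmxtVK _ uU).
by move=> ->.
Qed.

Lemma iter_conjE U A k :
  iter k (conj_by U) A = U^t* ^+ k *m A *m U ^+ k.
Proof.
elim: k => [|k IH]; first by rewrite !expr0 mul1mx mulmx1.
by rewrite iterS IH /conj_by exprS exprSr -!mulmxE !mulmxA.
Qed.

End SpectralData.

(** * Real powers on compact intervals *)

Section RealPower.
Context {R : realType}.
Implicit Types (a b q r l x y s t : R).

Lemma powR_le_sum a b q x : 0 < a -> a <= x <= b -> x `^ q <= a `^ q + b `^ q.
Proof.
move=> a0 /andP[ax xb]; have x0 := lt_le_trans a0 ax.
have b0 := lt_le_trans x0 xb.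
have [q0|q0] := leP 0 q.
  by rewrite ler_wpDl ?powR_ge0 // ge0_ler_powR // nnegrE ltW.
rewrite ler_wpDr ?powR_ge0 // -(opprK q) [leLHS]powRN [leRHS]powRN.
rewrite lef_pV2 ?posrE ?powR_gt0 //.
by apply: ge0_ler_powR; rewrite ?nnegrE ?oppr_ge0 ?(ltW a0) ?(ltW x0) ?(ltW q0).
Qed.

Lemma powR_ge_inv_sum a b q x : 0 < a -> a <= x <= b ->
  (a `^ (- q) + b `^ (- q))^-1 <= x `^ q.
Proof.
move=> a0 axb; have x0 : 0 < x by case/andP: axb => + _; exact: lt_le_trans.
rewrite -[q in leRHS]opprK [leRHS]powRN lef_pV2 ?posrE ?powR_gt0 //.
  exact: powR_le_sum.
by rewrite ltr_wpDr ?powR_ge0 ?powR_gt0.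
Qed.

(** Mean value theorem; the derivative [q z^(q-1)] is monotone in [z], whence it
    is bounded by the sum of its values at both ends. *)
Lemma powR_lipschitz a b q : 0 < a ->
  exists2 L, 0 <= L & forall x y, a <= x <= b -> a <= y <= b ->
    `|x `^ q - y `^ q| <= L * `|x - y|.
Proof.
move=> a0; pose L := `|q| * (a `^ (q - 1) + b `^ (q - 1)).
have L0 : 0 <= L by rewrite mulr_ge0 // addr_ge0 ?powR_ge0.
exists L => //.
suff H x y : a <= x -> x < y -> y <= b -> `|y `^ q - x `^ q| <= L * `|y - x|.
  move=> x y /andP[ax xb] /andP[ay yb]; have [xy|yx|->] := ltgtP x y.
  - by rewrite distrC (distrC x) H.
  - by rewrite H.
  - by rewrite !subrr normr0 mulr0.
move=> ax xy yb; have x0 := lt_le_trans a0 ax.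
have der z : z \in `]x, y[%R ->
    is_derive z 1 (fun u : R => u `^ q) (q * z `^ (q - 1)).
  rewrite in_itv /= => /andP[xz _]; apply: is_derive1_powR.
  exact: lt_trans xz.
have cont : {within `[x, y], continuous (fun u : R => u `^ q)}.
  apply: derivable_within_continuous => z; rewrite in_itv /= => /andP[xz _].
  apply: derivable_powR; rewrite in_itv /= andbT; exact: lt_le_trans xz.
have [z + ->] := MVT xy der cont; rewrite in_itv /= => /andP[xz zy].
rewrite normrM ler_wpM2r // normrM ler_wpM2l // ger0_norm ?powR_ge0 //.
apply: powR_le_sum => //; apply/andP; split; apply: ltW.
  exact: le_lt_trans xz.
exact: lt_le_trans yb.
Qed.

End RealPower.

Local Open Scope complex_scope.

(** * The induced Aluthge transformation of a power mean *)

Section ComplexMatrices.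
Context {R : realType} {m : nat}.
Implicit Types (A B U V T P : 'M[R[i]]_m) (a b q r l x y s t : R) (z : R[i]).
Implicit Types (f g : R -> R).

(** The kernel of the induced Aluthge transformation is the power mean of [s]
    and [t]. *)
Lemma power_mean_fun_homogeneous r l s t :
  r != 0 -> 0 < l < 1 -> 0 < s -> 0 < t ->
  s * power_mean_fun r l (t / s) = ((1 - l) * s `^ r + l * t `^ r) `^ r^-1.
Proof.
move=> r0 /andP[l0 l1] s0 t0; rewrite /power_mean_fun.
have e : s = (s `^ r) `^ r^-1 by rewrite -powRrM mulfV // powRr1 // ltW.
rewrite {1}e -powRM ?powR_ge0 //; last first.
  by rewrite addr_ge0 ?mulr_ge0 ?powR_ge0 ?subr_ge0 // ltW.
congr (_ `^ _); rewrite mulrDr mulrC; congr (_ + _).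
rewrite mulrCA -powRM ?divr_ge0 1?ltW //; congr (_ * _ `^ _).
by rewrite mulrC divfK // gt_eqF.
Qed.

(** A function on the reals as a function on the complex numbers; only its
    values at real points matter. *)
Definition lift_real f z : R[i] := (f (complex.Re z))%:C.

Lemma mxfunE f A : mxfun f A = calc (lift_real f) A. Proof. by []. Qed.

Lemma between_real a b z : a%:C <= z <= b%:C ->
  exists2 x, z = x%:C & a <= x <= b.
Proof.
case: z => x y; rewrite !lecE /= => /andP[/andP[/eqP -> ax] /andP[_ xb]].
by exists x => //; rewrite ax.
Qed.

Lemma real_complex_gt0 x : 0 < x -> (0 : R[i]) < x%:C.
Proof. by move=> x0; have : 0%:C < x%:C by rewrite ltcR. Qed.

Lemma mxfun_id f a b A : spectrum_within a%:C b%:C A ->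
  (forall x, a <= x <= b -> f x = x) -> mxfun f A = A.
Proof.
move=> wA fg; rewrite !mxfunE; apply: calc_id wA _ => _ /between_real[x -> hx].
by rewrite /lift_real fg.
Qed.

Lemma within_mxfun f a b a' b' A : spectrum_within a%:C b%:C A ->
  (forall x, a <= x <= b -> a' <= f x <= b') ->
  spectrum_within a'%:C b'%:C (mxfun f A).
Proof.
move=> wA fg; rewrite !mxfunE.
apply: within_calc wA _ => _ /between_real[x -> hx].
by rewrite /lift_real !lecR; exact: fg.
Qed.

Lemma mxfun_comp f g A : A \is normalmx ->
  mxfun f (mxfun g A) = mxfun (f \o g) A.
Proof. by move=> nA; rewrite !mxfunE calc_comp. Qed.

(** The bounds are sums over both ends, so they hold for either sign of [q]. *)
Lemma within_mxpower a b q A : 0 < a -> spectrum_within a%:C b%:C A ->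
  spectrum_within (a `^ (- q) + b `^ (- q))^-1%:C (a `^ q + b `^ q)%:C
    (mxpower A q).
Proof.
move=> a0 wA; apply: within_mxfun wA _ => x hx.
by rewrite powR_ge_inv_sum // powR_le_sum.
Qed.

Lemma mxpowerK a b q A : 0 < a -> q != 0 -> spectrum_within a%:C b%:C A ->
  mxpower (mxpower A q) q^-1 = A.
Proof.
move=> a0 q0 wA; rewrite /mxpower mxfun_comp; last exact: within_normal wA.
apply: mxfun_id wA _ => x /andP[ax _] /=.
by rewrite -powRrM mulfV // powRr1 // ltW // (lt_le_trans a0).
Qed.

Lemma mxabs_unitary_mul a b U P : 0 < a -> U \is unitarymx ->
  spectrum_within a%:C b%:C P -> mxabs (U *m P) = P.
Proof.
move=> a0 uU wP; rewrite /mxabs mxfunE.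
apply: calc_sqrt_adj_mul wP _ => //; first by rewrite ler0c ltW.
move=> _ /between_real[x -> /andP[ax _]].
rewrite /lift_real -rmorphXn /= sqrtr_sqr ger0_norm // ltW //.
exact: lt_le_trans ax.
Qed.

Lemma polar_unitary_mul a b U P : 0 < a -> U \is unitarymx ->
  spectrum_within a%:C b%:C P -> polar_unitary (U *m P) = U.
Proof.
move=> a0 uU wP; rewrite /polar_unitary (mxabs_unitary_mul a0 uU wP) mulmxK //.
apply: within_unit wP; exact: real_complex_gt0.
Qed.

Lemma distinct_eigenvaluesP a b P s : 0 < a ->
  spectrum_within a%:C b%:C P -> s \in distinct_eigenvalues P -> 0 < s.
Proof.
move=> a0 wP; rewrite mem_undup => /mapP[i _ ->].
have [x -> /andP[ax _]] := between_real (within_spectral_diag i wP).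
exact: lt_le_trans ax.
Qed.

Lemma sum_spectral_projection a b P : spectrum_within a%:C b%:C P ->
  \sum_(s <- distinct_eigenvalues P)
    calc (fun z => (z == s%:C)%:R) P = 1%:M.
Proof.
move=> wP; apply: (sum_calc_proj (e := real_complex R)) => i.
have [x ex _] := between_real (within_spectral_diag i wP).
have xS : x \in distinct_eigenvalues P.
  by rewrite mem_undup; apply/mapP; exists i; rewrite ?mem_enum // ex.
rewrite (bigD1_seq x) ?undup_uniq //= ex eqxx big1 ?addr0 // => s sx.
by rewrite (inj_eq (@complexI R)) eq_sym (negbTE sx).
Qed.

Lemma induced_aluthge_mul a b f U P : 0 < a -> U \is unitarymx ->
  spectrum_within a%:C b%:C P ->
  induced_aluthge f (U *m P) =
  \sum_(s <- distinct_eigenvalues P) \sum_(t <- distinct_eigenvalues P)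
    (s * f (t / s))%:C *: (calc (fun z => (z == s%:C)%:R) P *m U *m
                           calc (fun z => (z == t%:C)%:R) P).
Proof.
move=> a0 uU wP; rewrite /induced_aluthge.
rewrite (mxabs_unitary_mul a0 uU wP) (polar_unitary_mul a0 uU wP).
apply: eq_bigr => s _; apply: eq_bigr => t _.
have nP := within_normal wP.
have eP u : spectral_projection P u = calc (fun z => (z == u%:C)%:R) P.
  exact: proj_ortho_calc.
by rewrite -!eP.
Qed.

(** One step of the induced Aluthge transformation of [U A^(1/r)] leaves [U]
    unchanged and replaces [A] by [average l U A]. *)
Lemma induced_aluthge_power_mean a b r l U A :
  0 < a -> r != 0 -> 0 < l < 1 -> U \is unitarymx ->
  spectrum_within a%:C b%:C A -> commuting_conjugates U A \/ r = 1 ->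
  induced_aluthge (power_mean_fun r l) (U *m mxpower A r^-1) =
  U *m mxpower (average l%:C U A) r^-1.
Proof.
move=> a0 r0 l01 uU wA hr; set P := mxpower A r^-1.
have wP := within_mxpower r^-1 a0 wA; rewrite -/P in wP.
set a' := (_ + _)^-1 in wP; set b' := _ + _ in wP.
have a'0 : 0 < a'.
  have b0 : 0 <= b `^ (- r^-1) by exact: powR_ge0.
  by rewrite invr_gt0 ltr_wpDr ?powR_gt0.
have eA : mxpower P r = A.
  by have := mxpowerK a0 (invr_neq0 r0) wA; rewrite invrK.
have l0 : 0 <= l by case/andP: l01 => /ltW.
have l1 : l <= 1 by case/andP: l01 => _ /ltW.
rewrite (induced_aluthge_mul _ a'0 uU wP).
have sumE := sum_spectral_projection wP.
have nP := within_normal wP; have nA := within_normal wA.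
have l01C : (0 : R[i]) <= l%:C <= 1.
  by rewrite ler0c l0; have : l%:C <= 1%:C by rewrite lecR.
have a0C : (0 : R[i]) <= a%:C by rewrite ler0c ltW.
have waA : spectrum_within a%:C b%:C (average l%:C U A).
  exact: (within_average uU a0C l01C wA).
transitivity (\sum_(s <- distinct_eigenvalues P)
    \sum_(t <- distinct_eigenvalues P)
    (((1 - l) * s `^ r + l * t `^ r) `^ r^-1)%:C *:
      (calc (fun z => (z == s%:C)%:R) P *m U *m
       calc (fun z => (z == t%:C)%:R) P)).
  apply: eq_big_seq => s /(distinct_eigenvaluesP a'0 wP) s0.
  apply: eq_big_seq => t /(distinct_eigenvaluesP a'0 wP) t0.
  by rewrite power_mean_fun_homogeneous.
case: hr => [cA|r1].
  pose F := lift_real (fun x => x `^ r).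
  pose G := lift_real (fun x => x `^ r^-1).
  have eF : calc F P = A by exact: eA.
  have PA X : A *m X = X *m A -> P *m X = X *m P.
    by move=> AX; rewrite /P /mxpower mxfunE; apply: calc_intertwine.
  have := @sum_proj_calc _ _ _ _ (real_complex R) _ nP sumE F G U l%:C uU.
  rewrite eF => /(_ PA (commuting_conjugates_inv uU cA) (within_normal waA)) <-.
  apply: eq_bigr => s _; apply: eq_bigr => t _; congr (_ *: _).
  have -> : (1 - l%:C) * F s%:C + l%:C * F t%:C =
            ((1 - l) * s `^ r + l * t `^ r)%:C.
    by rewrite rmorphD !rmorphM rmorphB rmorph1.
  by [].
have powR1x x : 0 < x -> x `^ r^-1 = x.
  by move=> x0; rewrite r1 invr1 powRr1 ?ltW.
have -> : mxpower (average l%:C U A) r^-1 = average l%:C U A.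
  by apply: mxfun_id waA _ => x /andP[ax _]; exact/powR1x/(lt_le_trans a0).
have PA : P = A.
  by apply: mxfun_id wA _ => x /andP[ax _]; exact/powR1x/(lt_le_trans a0).
have -> : U *m average l%:C U A = (1 - l%:C) *: (P *m U) + l%:C *: (U *m P).
  rewrite PA /average mulmxDr -!scalemxAr !mulmxA.
  by rewrite (unitary_mulKadj uU) mul1mx.
rewrite -(sum_proj_affine nP sumE).
apply: eq_big_seq => s /(distinct_eigenvaluesP a'0 wP) s0.
apply: eq_big_seq => t /(distinct_eigenvaluesP a'0 wP) t0.
congr (_ *: _).
have st0 : 0 < (1 - l) * s + l * t.
  by case/andP: l01 => l0' l1'; rewrite addr_gt0 ?mulr_gt0 ?subr_gt0.
have -> : s `^ r = s by rewrite r1 powRr1 // ltW.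
have -> : t `^ r = t by rewrite r1 powRr1 // ltW.
by rewrite powR1x // rmorphD !rmorphM rmorphB rmorph1.
Qed.

End ComplexMatrices.

(** * Convergence *)

Section CvgFrob.
Context {C : numClosedFieldType} {m : nat}.

Lemma cvg_frob (X : nat -> 'M[C]_m) (Y : 'M[C]_m) :
  (forall e : C, 0 < e -> \forall n \near \oo, frob (X n - Y) < e) ->
  X n @[n --> \oo] --> Y.
Proof.
move=> h; apply/cvg_ballP => e e0.
have := h (e ^+ 2) (exprn_gt0 2 e0); apply: filterS => n hn.
split=> // i j; rewrite -ball_normE /= distrC.
rewrite -(ltr_pXn2r (n := 2)) ?nnegrE // ?(ltW e0) //.
apply: le_lt_trans hn; rewrite /frob (bigD1 i) //= (bigD1 j) //= !mxE.
rewrite -addrA lerDl addr_ge0 ?sumr_ge0 // => k _.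
  by rewrite exprn_ge0.
by rewrite sumr_ge0 // => k' _; rewrite exprn_ge0.
Qed.

End CvgFrob.

Section Convergence.
Context {R : realType} {m : nat}.
Implicit Types (A B U V T P : 'M[R[i]]_m) (a b q r l x y s t : R) (z : R[i]).

Lemma norm_real_complex x : `|x%:C| = `|x|%:C :> R[i].
Proof. by rewrite normc_def /= expr0n addr0 sqrtr_sqr. Qed.

Lemma mxpower_lipschitz a b q : 0 < a ->
  exists2 L : R, 0 <= L & forall A B,
    spectrum_within a%:C b%:C A -> spectrum_within a%:C b%:C B ->
    frob (mxpower A q - mxpower B q) <= (L ^+ 2)%:C * frob (A - B).
Proof.
move=> a0; have [L L0 hL] := @powR_lipschitz R a b q a0.
exists L => // A B wA wB; rewrite rmorphXn /=.
apply: (calc_lipschitz _ _ wA wB); first by rewrite ler0c.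
move=> _ _ /between_real[x -> hx] /between_real[y -> hy].
rewrite /lift_real /= -!rmorphB !norm_real_complex -rmorphM /= lecR.
exact: hL.
Qed.

(** The diagonal coefficients in the basis [V] are fixed by averaging, and the
    others decay geometrically. *)
Lemma cvg_frob_iter_average l U V (alpha : 'rV[R[i]]_m) A (e : R) :
  0 < l < 1 -> U \is unitarymx -> V \is unitarymx ->
  U = V^t* *m diag_mx alpha *m V ->
  (forall i j, i != j -> alpha 0 i != alpha 0 j) -> 0 < e ->
  \forall n \near \oo, frob (iter n (average l%:C U) A - pinching V A) < e%:C.
Proof.
move=> /andP[l0 l1] uU uV eU halpha e0.
have lC : (0 : R[i]) < l%:C < 1.
  rewrite real_complex_gt0 //=; have : l%:C < 1%:C by rewrite ltcR.
  by [].
pose c i j : R[i] := (1 - l%:C) * ((alpha 0 i)^*%R * alpha 0 j) + l%:C.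
pose rho i j : R := complex.Re (c i j) ^+ 2 + complex.Im (c i j) ^+ 2.
pose Q := V *m A *m V^t*.
pose w i j : R := complex.Re (Q i j) ^+ 2 + complex.Im (Q i j) ^+ 2.
have rhoE i j : `|c i j| ^+ 2 = (rho i j)%:C by rewrite -add_Re2_Im2.
have wE i j : `|Q i j| ^+ 2 = (w i j)%:C by rewrite -add_Re2_Im2.
have frobK n : frob (iter n (average l%:C U) A - pinching V A) =
    (\sum_i \sum_(j | j != i) geometric (w i j) (rho i j) n)%:C.
  rewrite (frob_iter_average _ _ lC uU uV eU) rmorph_sum /=.
  apply: eq_bigr => i _; rewrite rmorph_sum /=; apply: eq_bigr => j _.
  by rewrite -/(c i j) -/Q rhoE wE -rmorphXn -rmorphM mulrC.
have alpha1 i := unitary_diag_norm i uU uV eU.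
have rho1 i j : j != i -> `|rho i j| < 1.
  move=> ji; rewrite ger0_norm ?addr_ge0 ?sqr_ge0 //.
  have c1 : `|c i j| < 1.
    apply: norm_average_lt1 => //.
      by rewrite normrM norm_conjC !alpha1 mulr1.
    apply: contraNneq (halpha _ _ ji) => ij.
    have := congr1 (fun z => alpha 0 i * z) ij.
    by rewrite mulrA -normCK alpha1 expr1n mul1r mulr1 => ->.
  have : (rho i j)%:C < 1%:C by rewrite -rhoE expr_lt1.
  by rewrite ltcR.
have cvgK : (\sum_i \sum_(j | j != i) geometric (w i j) (rho i j) n)
    @[n --> \oo] --> (0 : R).
  rewrite -[X in _ --> X](@big1_eq R 0 +%R _ (index_enum 'I_m) predT).
  apply: (@cvg_big R _ +%R 0); first exact: add_continuous.
  move=> i _.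
  rewrite -[X in _ --> X](@big1_eq R 0 +%R _ (index_enum 'I_m)
    (fun j => j != i)).
  apply: (@cvg_big R _ +%R 0); first exact: add_continuous.
  by move=> j ji; apply: cvg_geometric; exact: rho1.
have small : \forall n \near \oo,
    \sum_i \sum_(j | j != i) geometric (w i j) (rho i j) n < e.
  exact: cvgr_lt cvgK _ e0.
by apply: filterS small => n; rewrite frobK ltcR.
Qed.

End Convergence.

Section Main.
Context {R : realType} {m : nat}.
Implicit Types (A B U V T P : 'M[R[i]]_m) (a b q r l x y s t : R) (z : R[i]).

Lemma gram_normal T : T^t* *m T \is normalmx.
Proof. by apply: adj_normal; rewrite adjmxM trmxCK. Qed.

(** The bounds are read off the eigenvalues: [b] is their sum, and [1/a] exceeds
    the sum of their inverses by 1, which also covers dimension 0. *)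
Lemma mxabs_within T : mxabs T \in unitmx ->
  exists a b : R, 0 < a /\ spectrum_within a%:C b%:C (mxabs T).
Proof.
rewrite /mxabs mxfunE => uP.
have [W [p [uW _ fP]]] := calc_normal (gram_normal T).
pose x i := Num.sqrt (complex.Re (p 0 i)).
have x_neq0 i : x i != 0.
  have := uP; rewrite fP => /(unit_diag_neq0 uW)/(_ i).
  by rewrite mxE; apply: contra => /eqP h; rewrite /lift_real -/(x i) h.
have x_gt0 i : 0 < x i by rewrite lt_def x_neq0 sqrtr_ge0.
have xV_ge0 i : 0 <= (x i)^-1 by rewrite invr_ge0 ltW.
exists (1 + \sum_i (x i)^-1)^-1, (\sum_i x i); split.
  by rewrite invr_gt0 ltr_pwDl // sumr_ge0.
rewrite fP; exists W, (map_mx (lift_real Num.sqrt) p); split=> // i.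
rewrite mxE /lift_real -/(x i) !lecR; apply/andP; split.
  rewrite -[leRHS]invrK lef_pV2 ?posrE ?invr_gt0 //; last first.
    by rewrite ltr_pwDl // sumr_ge0.
  by rewrite (bigD1 i) //= addrCA lerDl addr_ge0 ?sumr_ge0.
by rewrite (bigD1 i) //= lerDl sumr_ge0 // => j _; rewrite ltW.
Qed.

Lemma centered_commuting T U : T \in unitmx -> U \is unitarymx ->
  T = U *m mxabs T -> centered T -> commuting_conjugates U (mxabs T).
Proof.
move=> uT uU eT cT.
have uP : mxabs T \in unitmx by move: uT; rewrite {1}eT unitmx_mul => /andP[].
have eU : polar_unitary T = U by rewrite /polar_unitary {1}eT mulmxK.
have mem k : centered_family T (iter k (conj_by U) (mxabs T)).
  case: k => [|k]; first by left; right.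
  by left; left; exists k.+1 => //; rewrite eU iter_conjE.
by move=> j k; apply: cT.
Qed.

End Main.

Theorem corollary8p2 (R : realType) (m : nat) (lambda r : R)
    (T U V : 'M[R[i]]_m) (alpha : 'rV[R[i]]_m)
    (hlambda : 0 < lambda < 1)
    (hr : -1 <= r <= 1) (hr0 : r != 0)
    (hT : T \in unitmx)
    (hU : U \is unitarymx) (hTU : T = U *m mxabs T)
    (hV : V \is unitarymx)
    (hUV : U = V^t* *m diag_mx alpha *m V)
    (halpha : forall i j : 'I_m, i != j -> alpha 0 i != alpha 0 j)
    (hcentered : centered T \/ r = 1) :
  iter n (induced_aluthge (power_mean_fun r lambda)) T @[n --> \oo] -->
  U *m mxpower
         (V^t* *m hadamard 1%:M (V *m mxpower (mxabs T) r *m V^t* ) *m V) r^-1.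
Proof.
(* [T = U A^(1/r)], where the spectrum of [A = |T|^r] is in [[a', b']] and
   [a' > 0]; these bounds persist along the iteration. *)
have uP : mxabs T \in unitmx by move: hT; rewrite {1}hTU unitmx_mul => /andP[].
have [a [b [a0 wP]]] := mxabs_within uP.
set A := mxpower (mxabs T) r.
have wA := within_mxpower r a0 wP; rewrite -/A in wA.
have eP : mxpower A r^-1 = mxabs T by exact: mxpowerK wP.
set a' := (_ + _)^-1 in wA; set b' := _ + _ in wA.
have a'0 : 0 < a' by rewrite invr_gt0 ltr_wpDr ?powR_ge0 ?powR_gt0.
have l0 : (0 : R[i]) <= lambda%:C <= 1.
  case/andP: hlambda => l0 l1; rewrite ler0c ltW //=.
  have : lambda%:C <= 1%:C by rewrite lecR ltW.
  by [].
have a'0C : (0 : R[i]) <= a'%:C by rewrite ler0c ltW.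
pose An n := iter n (average lambda%:C U) A.
have wAn n : spectrum_within a'%:C b'%:C (An n).
  by elim: n => //= n IH; exact: (within_average hU a'0C l0 IH).
have cAn n : commuting_conjugates U (An n) \/ r = 1.
  case: hcentered => [cT|]; [left|by right].
  elim: n => [|n IH]; last exact: commuting_conjugates_average.
  have cP := centered_commuting hT hU hTU cT.
  exact: (commuting_conjugates_calc _ hU (within_normal wP) cP).
have iterE n : iter n (induced_aluthge (power_mean_fun r lambda)) T =
    U *m mxpower (An n) r^-1.
  elim: n => [|n IH]; first by rewrite /= eP.
  rewrite iterS IH.
  exact: (induced_aluthge_power_mean a'0 hr0 hlambda hU (wAn n) (cAn n)).
have -> : V^t* *m hadamard 1%:M (V *m A *m V^t*) *m V = pinching V A.
  exact/esym/pinching_hadamard.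
have wLim := within_pinching hV wA.
have [L L0 hL] := @mxpower_lipschitz R m a' b' r^-1 a'0.
apply: cvg_frob => e e0.
have [d d0 de] : exists2 d : R, 0 < d & (L ^+ 2 * d)%:C < e.
  case: e e0 => x y; rewrite ltcE /= => /andP[/eqP -> x0].
  (* The summand 1 avoids a division by zero when [L = 0]. *)
  exists (x / (L ^+ 2 + 1)).
    by rewrite divr_gt0 // ltr_wpDl ?sqr_ge0.
  rewrite ltcE /= eqxx /= mulrA ltr_pdivrMr; last by rewrite ltr_wpDl ?sqr_ge0.
  by rewrite mulrDr mulr1 mulrC ltrDl.
have := cvg_frob_iter_average A hlambda hU hV hUV halpha d0.
apply: filterS => n hn; rewrite iterE -mulmxBr (frob_unitaryl _ hU).
apply: le_lt_trans (hL _ _ (wAn n) wLim) _; apply: le_lt_trans de.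
rewrite (rmorphM (real_complex R) (L ^+ 2) d).
by apply: ler_wpM2l (ltW hn); rewrite ler0c sqr_ge0.
Qed.
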